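(* Let $A,B\subseteq S\subseteq V$ with $A\cap B=\emptyset$. Then the following statements are equivalent: (a) $Y_A$ is Granger non-causal for $Y_B$ with respect to $Y_S$, i.e. $\mathcal{L}_{Y_B}(t,t+1)\perp\mathcal{L}_{Y_A}(t)\mid\mathcal{L}_{Y_{S\setminus A}}(t)$ for all $t\in\mathbb{R}$. (b) $\mathcal{L}_{Y_B}(t+1)\perp\mathcal{L}_{Y_A}(t)\mid\mathcal{L}_{Y_{S\setminus A}}(t)$ for all $t\in\mathbb{R}$. (c) $\ell_{Y_B}(t,t+1)\perp\ell_{Y_A}(-\infty,t)\mid\mathcal{L}_{Y_{S\setminus A}}(t)$ for all $t\in\mathbb{R}$. (d) $\ell_{Y_b}(s,s)\perp\ell_{Y_a}(s',s')\mid\mathcal{L}_{Y_{S\setminus A}}(t)$ for all $a\in A$, $b\in B$, $s\in[t,t+1]$, $s'\le t$, $t\in\mathbb{R}$.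
   Context: $V=\{1,\ldots,k\}$ and $Y_V=(Y_V(t))_{t\in\mathbb{R}}$ is a $k$-dimensional weakly stationary stochastic process with expectation zero that is continuous in mean square, with components $Y_v=(Y_v(t))_{t\in\mathbb R}$, $v\in V$, and subprocesses $Y_A=(Y_a)_{a\in A}$ for $A\subseteq V$. $L^2=L^2(\Omega,\mathcal F,\mathbb P)$ is the Hilbert space of square-integrable complex-valued random variables with $\langle X,Y\rangle=\mathbb{E}[X\overline{Y}]$ (a.s. equal variables identified). $P_{\mathcal L}$ is the orthogonal projection onto a closed linear subspace $\mathcal L$. For $A\subseteq V$ and $-\infty\le s\le t\le\infty$, $\ell_{Y_A}(s,t)$ is the (not necessarily closed) complex linear span of $\{Y_a(u):a\in A,\ u\in[s,t]\cap\mathbb{R}\}$, $\mathcal{L}_{Y_A}(s,t)$ is its closure in $L^2$, and $\mathcal{L}_{Y_A}(t)=\mathcal{L}_{Y_A}(-\infty,t)$ (equal to $\{0\}$ if $A=\emptyset$). For linear subspaces $\mathcal{L}_1,\mathcal{L}_2$ and a closed subspace $\mathcal{L}_3$ of $L^2$, $\mathcal{L}_1\perp\mathcal{L}_2\mid\mathcal{L}_3$ (conditional orthogonality) means $\mathbb{E}[(X-P_{\mathcal{L}_3}X)\overline{(Y-P_{\mathcal{L}_3}Y)}]=0$ for all $X\in\mathcal{L}_1$, $Y\in\mathcal{L}_2$. *)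

(* Defs.v *)
From HB Require Import structures.
From mathcomp Require Import all_boot all_order all_algebra.
From mathcomp Require Import all_classical all_reals all_analysis.
From mathcomp Require Import complex.

Set Implicit Arguments.
Unset Strict Implicit.
Unset Printing Implicit Defensive.

Import Order.TTheory GRing.Theory Num.Theory.
Import numFieldNormedType.Exports.

Local Open Scope classical_set_scope.
Local Open Scope ring_scope.
Local Open Scope complex_scope.

(* Elements of L^2 are represented by functions Omega -> R[i]. The
   identification of a.s. equal variables is built into the definitions:
   [linspan] is saturated for a.s. equality by construction, [L2closure] because
   a.s. equal variables are at [L2norm]-distance 0, and [cexpect] does not see
   null sets. *)

Section ComplexL2.
Context d (Omega : measurableType d) (R : realType) (P : probability Omega R).
Implicit Types (X Y Z W : Omega -> R[i]) (F L : set (Omega -> R[i])).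

Definition L2 : set (Omega -> R[i]) :=
  [set X | (fun w => complex.Re (X w)) \in Lfun P 2%:E /\
           (fun w => complex.Im (X w)) \in Lfun P 2%:E].

(* [fine] is harmless whenever X is integrable, e.g. for X in L^2 or for a
   product of two elements of L^2. *)
Definition cexpect X : R[i] :=
  fine ('E_P[fun w => complex.Re (X w)]) +i*
  fine ('E_P[fun w => complex.Im (X w)]).

Definition L2inner X Y : R[i] := cexpect (fun w => X w * (Y w)^*%C).

Definition L2norm X : R := Num.sqrt (complex.Re (L2inner X X)).

Definition L2closure L : set (Omega -> R[i]) :=
  [set X | L2 X /\ forall e : R, 0 < e -> exists2 Z, L Z & L2norm (X \- Z) < e].

Definition linspan F : set (Omega -> R[i]) :=
  [set X | L2 X /\
    exists n (c : 'I_n -> R[i]) (f : 'I_n -> Omega -> R[i]),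
      (forall i, F (f i)) /\
      {ae P, forall w, X w = \sum_(i < n) c i * f i w}].

Definition is_oproj L X Z : Prop :=
  L Z /\ forall W, L W -> L2inner (X \- Z) W = 0.

(* A version of P_L X: for X in L^2 and L a closed linear subspace of L^2 it
   exists and is a.s. unique; the default value 0 is used only if no element of
   L satisfies [is_oproj]. *)
Definition oproj L X : Omega -> R[i] := xget (fun=> 0) [set Z | is_oproj L X Z].

Definition cond_orth (K1 K2 L : set (Omega -> R[i])) : Prop :=
  forall X Y, K1 X -> K2 Y -> L2inner (X \- oproj L X) (Y \- oproj L Y) = 0.

End ComplexL2.

(* Processes take values in R[i]^k; this contains the R^k-valued ones. *)
Section Processes.
Context d (Omega : measurableType d) (R : realType) (P : probability Omega R).
Context (k : nat) (Y : 'I_k -> R -> Omega -> R[i]).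

Definition weakly_stationary : Prop :=
  [/\ forall v t, L2 P (Y v t),
      forall v s t, cexpect P (Y v s) = cexpect P (Y v t) &
      forall v w s t h,
        L2inner P (Y v (s + h)) (Y w (t + h)) = L2inner P (Y v s) (Y w t)].

Definition centered : Prop := forall v t, cexpect P (Y v t) = 0.

Definition ms_continuous : Prop :=
  forall v t, L2norm P (Y v s \- Y v t) @[s --> t] --> (0 : R).

Definition ell (A : {set 'I_k}) (s t : \bar R) : set (Omega -> R[i]) :=
  linspan P
    [set X | exists a u, [/\ a \in A, (s <= u%:E <= t)%E & X = Y a u]].

Definition calL (A : {set 'I_k}) (s t : \bar R) : set (Omega -> R[i]) :=
  L2closure P (ell A s t).

Definition calLpast (A : {set 'I_k}) (t : R) : set (Omega -> R[i]) :=
  calL A -oo%E t%:E.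

Definition Granger_noncausal (A B S : {set 'I_k}) : Prop :=
  forall t : R,
    cond_orth P (calL B t%:E (t + 1)%:E) (calLpast A t) (calLpast (S :\: A) t).

End Processes.

(* Main.v *)
Require Import Defs.
From mathcomp Require Import all_boot all_order all_algebra.
From mathcomp Require Import all_classical all_reals all_analysis.
From mathcomp Require Import measurable_realfun complex ring lra.

(** Conditional orthogonality given a closed subspace [L] only has to be tested
    on generators. Indeed the inner product of the residuals of [X] and [Y] with
    respect to [L] equals the inner product of the residual of [X] with [Y]
    itself ([L2inner_resid]); for fixed [X] its vanishing is preserved by linear
    combinations, almost sure equality and limits in [Y], and the same holds with
    [X] and [Y] exchanged. So the relation extends from generating sets to their
    closed linear spans ([cond_orth_span]).

    Given this, (b) implies (c) and (c) implies (d) because the spans shrink, and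
    (d) implies (a) because (d) is the assertion about single variables, which
    generate the subspaces in (a). For (a) implies (b), a generator [Y b u] of the
    past of [Y_B] up to [t + 1] is either in the window from [t] to [t + 1], where
    (a) applies, or it lies before [t]; in that case it belongs to the conditioning
    space, because [b] is in [S] but not in [A], and its residual vanishes
    ([cond_orth_self]).

    All of this needs the projections onto the closed spans to exist. The
    projection theorem ([is_oproj_ex]) is proved with a minimising sequence, which
    the parallelogram identity shows to be Cauchy, and the completeness of L^2
    ([L2_complete]). The latter reduces to real functions, for which almost
    everywhere convergence comes from a summable bound on the increments and the
    limit is controlled with Fatou's lemma ([Lfun2_complete]). *)

Set Implicit Arguments.
Unset Strict Implicit.
Unset Printing Implicit Defensive.

Import Order.TTheory GRing.Theory Num.Theory.
Import numFieldNormedType.Exports.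
Local Open Scope ring_scope.

(** * Completeness of the real L^2 *)

Section RealL2.
Local Open Scope classical_set_scope.
Context {d : measure_display} {T : measurableType d} {R : realType}.
Variable P : probability T R.
Implicit Types f g : T -> R.

Lemma Lfun2P f : f \in Lfun P 2%:E <->
  measurable_fun setT f /\ (\int[P]_x (f x ^+ 2)%:E < +oo)%E.
Proof.
split=> [/[dup] fL /andP[+ _]|[mf foo]].
  rewrite inE/= => mf; split=> //.
  exact: (integrable_lty measurableT (Lfun2_integrable_sqr fL)).
apply/andP; rewrite !inE/=; split=> //.
rewrite /finite_norm unlock poweR_lty//.
rewrite (eq_integral (fun x => (f x ^+ 2)%:E))// => x _ /=.
by rewrite powR_mulrn// real_normK// num_real.
Qed.

(** The integral of the sum is the sum of the integrals, so the sum is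
    integrable and hence finite almost everywhere. *)
Lemma ae_cvg_series (h : nat -> T -> R) (M : R) :
    (forall n, measurable_fun setT (h n)) -> (forall n x, 0 <= h n x) ->
    (\sum_(0 <= n <oo) \int[P]_x (h n x)%:E <= M%:E)%E ->
  {ae P, forall x, cvgn (series (h^~ x))}.
Proof.
move=> mh h0 hM.
have mS : measurable_fun setT
    (fun x => \sum_(0 <= n <oo) (h n x)%:E : \bar R)%E.
  apply: ge0_emeasurable_sum => [n x _ _|n _]; first by rewrite lee_fin.
  exact/measurable_EFinP.
have iS : P.-integrable setT (fun x => \sum_(0 <= n <oo) (h n x)%:E)%E.
  apply/integrableP; split=> //.
  apply: le_lt_trans (ltry M); apply: le_trans hM.
  rewrite -integral_nneseries//; last 2 first.
  - by move=> n; exact/measurable_EFinP.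
  - by move=> n x _; rewrite lee_fin.
  rewrite le_eqVlt; apply/orP; left; apply/eqP/eq_integral => x _ /=.
  by rewrite gee0_abs// nneseries_ge0// => *; rewrite lee_fin.
apply: filterS (integrable_ae measurableT iS) => x /(_ I) Sfin.
apply: nondecreasing_is_cvgn.
  apply/nondecreasing_seqP => n; rewrite seriesEnat/= big_nat_recr//=.
  by rewrite lerDl.
exists (fine (\sum_(0 <= n <oo) (h n x)%:E))%E => _ [n _ <-].
rewrite -lee_fin fineK// /series/= -sumEFin.
by apply: nneseries_lim_ge => k _ _; rewrite lee_fin.
Qed.

(** With [p = 2 ^ n], the inequality [|x| <= p * x ^ 2 + 1 / p] bounds the
    increment [|f n.+1 - f n|] by a function whose integral is at most [2 / p],
    the constant [1 / p] being integrable because [P] is finite. These integrals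
    are summable, so the increments are absolutely summable almost everywhere. *)
Lemma Lfun2_ae_cvg (f : nat -> T -> R) : (forall n, f n \in Lfun P 2%:E) ->
    (forall n m, (n <= m)%N ->
      (\int[P]_x ((f n x - f m x) ^+ 2)%:E <= (4^-1 ^+ n)%:E)%E) ->
  {ae P, forall x, cvgn (f^~ x)}.
Proof.
move=> fL fC.
pose p n : R := 2 ^+ n.
have p0 n : 0 < p n by rewrite exprn_gt0.
pose u n x := (f n x - f n.+1 x) ^+ 2.
pose h n x := p n * u n x + (p n)^-1.
have mu n : measurable_fun setT (u n).
  apply/measurable_funX/measurable_funB.
    by have /Lfun2P[] := fL n.
  by have /Lfun2P[] := fL n.+1.
have u0 n x : 0 <= u n x by exact: sqr_ge0.
have mh n : measurable_fun setT (h n).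
  by apply: measurable_funD => //; apply: measurable_funM.
have p0' n : 0 <= p n by exact: ltW.
have h0 n x : 0 <= h n x
  by apply: addr_ge0; rewrite ?invr_ge0//; apply: mulr_ge0.
have hint n : (\int[P]_x (h n x)%:E <= (4 / (2 ^ (n + 1))%:R)%:E)%E.
  under eq_integral => x _ do rewrite EFinD EFinM.
  rewrite ge0_integralD//; last 3 first.
  - by move=> x _; rewrite -EFinM lee_fin mulr_ge0.
  - by apply/measurable_EFinP; apply: measurable_funM.
  - by move=> x _; rewrite lee_fin invr_ge0.
  rewrite ge0_integralZl_EFin//; last 2 first.
  - by move=> x _; rewrite lee_fin.
  - exact/measurable_EFinP.
  rewrite integral_cst//= probability_setT mule1.
  apply: (@le_trans _ _ ((p n)%:E * (4^-1 ^+ n)%:E + ((p n)^-1)%:E)%E).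
    by rewrite leeD2r// lee_pmul2l ?fC// lte_fin.
  rewrite -EFinM -EFinD lee_fin natrX exprD expr1 -/(p n).
  have -> : (4^-1 : R) ^+ n = (p n)^-1 * (p n)^-1.
    by rewrite -invfM -exprMn -exprVn; congr (_^-1 ^+ _); ring.
  by rewrite le_eqVlt; apply/orP; left; apply/eqP; field; rewrite gt_eqF.
have hsum : (\sum_(0 <= n <oo) \int[P]_x (h n x)%:E <= 4%:E)%E.
  apply: le_trans (_ : _ <= \sum_(0 <= n <oo) (4 / (2 ^ (n + 1))%:R)%:E)%E _.
    apply: lee_nneseries => [n _ _|n _]; last exact: hint.
    by apply: integral_ge0 => x _; rewrite lee_fin.
  have := @cvg_geometric_eseries_half R 4 0; rewrite expr0 divr1.
  by move/cvg_lim => ->.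
apply: filterS (ae_cvg_series mh h0 hsum) => x hx.
(* Convergence of a sequence is convergence of its telescoping series. *)
have telx : cvgn (series (telescope (f^~ x))).
  apply: normed_cvg; apply: series_le_cvg hx => n;
    [exact: normr_ge0 | exact: h0 | rewrite /=].
  rewrite /telescope/= distrC /h /u.
  rewrite -[X in _ * X + _]real_normK ?num_real//.
  rewrite -(ler_pM2l (p0 n)) mulrDr mulfV ?gt_eqF//.
  set z := `|_|; have := sqr_ge0 (p n * z - 1).
  have : 0 <= p n * z by apply: mulr_ge0 => //; exact: normr_ge0.
  by rewrite !expr2; nra.
rewrite (_ : f^~ x = fun n => f 0 x + series (telescope (f^~ x)) n).
  by apply: is_cvgD => //; exact: is_cvg_cst.
by apply/funext => n; exact: (eq_sum_telescope (f^~ x)).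
Qed.

(** Riesz-Fischer. Stating the Cauchy hypothesis with a geometric rate makes the
    whole sequence converge almost everywhere; Fatou's lemma, with [n] fixed and
    [m] tending to infinity, carries the rate over to the limit. *)
Lemma Lfun2_complete (f : nat -> T -> R) : (forall n, f n \in Lfun P 2%:E) ->
    (forall n m, (n <= m)%N ->
      (\int[P]_x ((f n x - f m x) ^+ 2)%:E <= (4^-1 ^+ n)%:E)%E) ->
  exists2 g, g \in Lfun P 2%:E &
    forall n, (\int[P]_x ((f n x - g x) ^+ 2)%:E <= (4^-1 ^+ n)%:E)%E.
Proof.
move=> fL fC.
(* Unlike the pointwise limit, the limit superior is defined and measurable
   everywhere. *)
pose g x := fine (limn_esup (fun n => (f n x)%:E)).
have mf n : measurable_fun setT (f n) by have /Lfun2P[] := fL n.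
have mg : measurable_fun setT g.
  apply: measurableT_comp; first exact: fine_measurable.
  by apply: measurable_fun_limn_esup => n; exact/measurable_EFinP.
have fg : {ae P, forall x, f n x @[n --> \oo] --> g x}.
  apply: filterS (Lfun2_ae_cvg fL fC) => x fx.
  suff -> : g x = limn (f^~ x) by [].
  have fxE : (f n x)%:E @[n --> \oo] --> (limn (f^~ x))%:E.
    by apply: cvg_EFin => //; exact: nearW.
  by have [_ E] := cvg_limn_einf_sup fxE; rewrite /g E.
have gint n : (\int[P]_x ((f n x - g x) ^+ 2)%:E <= (4^-1 ^+ n)%:E)%E.
  pose w m x : \bar R := ((f n x - f m x) ^+ 2)%:E.
  have mw m : measurable_fun setT (w m).
    by apply/measurable_EFinP/measurable_funX/measurable_funB.
  have w0 m x : (0 <= w m x)%E by rewrite lee_fin sqr_ge0.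
  rewrite (_ : integral _ _ _ = \int[P]_x limn_einf (w^~ x))%E; last first.
    apply: ge0_ae_eq_integral => //.
    - by apply/measurable_EFinP/measurable_funX/measurable_funB.
    - apply: measurableT_comp; first exact: oppe_measurable.
      by apply: measurable_fun_limn_esup => m; exact: measurableT_comp.
    - by move=> x _; rewrite lee_fin sqr_ge0.
    - move=> x _; rewrite limn_einf_lim; apply: lime_ge.
        exact: is_cvg_einfs.
      by apply: nearW => m; apply: le_ereal_inf_tmp => _ [k _ <-].
    apply: filterS fg => x fgx _.
    have wxE : w m x @[m --> \oo] --> ((f n x - g x) ^+ 2)%:E.
      apply: cvg_EFin; first exact: nearW.
      by apply: cvgM; apply: cvgB => //; exact: cvg_cst.
    by have [E _] := cvg_limn_einf_sup wxE; rewrite E.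
  apply: le_trans (fatou P measurableT mw (fun m x _ => w0 m x)) _.
  rewrite limn_einf_lim; apply: lime_le; first exact: is_cvg_einfs.
  apply: nearW => k; apply: le_trans (fC n (maxn n k) (leq_maxl _ _)).
  by apply: ereal_inf_lbound; exists (maxn n k) => //=; exact: leq_maxr.
exists g => //.
have -> : g = f 0 - (f 0 - g) by rewrite opprB addrC subrK.
suff Lg : f 0 - g \in Lfun P 2%:E by rewrite rpredB ?lee1n//= => _; exact: fL.
apply/Lfun2P; split.
  exact: measurable_funB.
exact: le_lt_trans (gint 0) (ltry _).
Qed.

End RealL2.

(** * The inner product of square-integrable complex random variables *)

Section Inner.
Local Open Scope classical_set_scope.
Local Open Scope complex_scope.
Context {d : measure_display} {T : measurableType d} {R : realType}.
Variable P : probability T R.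
Implicit Types (X Y Z U W : T -> R[i]) (c z : R[i]).
Implicit Types (L M F G : set (T -> R[i])).

Definition L1 X :=
  (fun w => complex.Re (X w)) \in Lfun P 1 /\
  (fun w => complex.Im (X w)) \in Lfun P 1.

Lemma complexP (a b : R[i]) :
  complex.Re a = complex.Re b -> complex.Im a = complex.Im b -> a = b.
Proof. by case: a b => [? ?] [? ?] /= -> ->. Qed.

Lemma fine_expectationD (f g : T -> R) : f \in Lfun P 1 -> g \in Lfun P 1 ->
  fine 'E_P[fun w => f w + g w] = fine 'E_P[f] + fine 'E_P[g].
Proof.
move=> f1 g1; rewrite -fineD ?expectation_fin_num//.
by rewrite -expectationD.
Qed.

Lemma fine_expectationZ (a : R) (f : T -> R) : f \in Lfun P 1 ->
  fine 'E_P[fun w => a * f w] = a * fine 'E_P[f].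
Proof.
move=> f1; rewrite -[a in RHS]/(fine a%:E) -fineM ?expectation_fin_num//.
rewrite -expectationZl//; congr (fine (expectation _ _)).
by apply/funext => w /=; rewrite mulrC.
Qed.

Lemma Lfun_mull (a : R) (f : T -> R) (p : R) : 1 <= p -> f \in Lfun P p%:E ->
  (fun w => a * f w) \in Lfun P p%:E.
Proof.
move=> p1 fL; rewrite (_ : (fun w => _) = a \o* f); first exact: Lfun_scale.
by apply/funext => w /=; rewrite mulrC.
Qed.

Lemma Lfun_add (f g : T -> R) (p : R) : 1 <= p -> f \in Lfun P p%:E ->
  g \in Lfun P p%:E -> (fun w => f w + g w) \in Lfun P p%:E.
Proof. by move=> p1 fL gL; apply: (Lfun_addr_closed P _).2. Qed.

Lemma cexpectD X Y : L1 X -> L1 Y ->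
  cexpect P (fun w => X w + Y w) = cexpect P X + cexpect P Y.
Proof.
move=> [X1 X2] [Y1 Y2]; apply: complexP; rewrite /cexpect /=.
  rewrite -fine_expectationD//; congr (fine (expectation _ _)).
  by apply/funext => w; case: (X w) (Y w) => [? ?] [? ?].
rewrite -fine_expectationD//; congr (fine (expectation _ _)).
by apply/funext => w; case: (X w) (Y w) => [? ?] [? ?].
Qed.

Lemma cexpectZ c X : L1 X -> cexpect P (fun w => c * X w) = c * cexpect P X.
Proof.
move=> [X1 X2]; case: c => a b; apply: complexP; rewrite /cexpect /=.
  rewrite -mulNr -!fine_expectationZ// -fine_expectationD ?(@Lfun_mull _ _ 1)//.
  congr (fine (expectation _ _)).
  by apply/funext => w; case: (X w) => [? ?] /=; rewrite mulNr.
rewrite -!fine_expectationZ// -fine_expectationD ?(@Lfun_mull _ _ 1)//.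
congr (fine (expectation _ _)).
by apply/funext => w; case: (X w) => [? ?].
Qed.

Lemma cexpect_conj X : L1 X -> cexpect P (fun w => (X w)^*) = (cexpect P X)^*.
Proof.
move=> [X1 X2]; apply: complexP; rewrite /cexpect /=.
  congr (fine (expectation _ _)).
  by apply/funext => w; case: (X w) => [? ?].
rewrite -mulN1r -fine_expectationZ//; congr (fine (expectation _ _)).
by apply/funext => w; case: (X w) => [? ?] /=; rewrite mulN1r.
Qed.

Lemma L2_mul_conj X Y : L2 P X -> L2 P Y -> L1 (fun w => X w * (Y w)^*).
Proof.
move=> [X1 X2] [Y1 Y2]; split.
  rewrite (_ : (fun w => _) = fun w =>
    complex.Re (X w) * complex.Re (Y w) + complex.Im (X w) * complex.Im (Y w)).
    by apply: Lfun_add => //; exact: Lfun2_mul_Lfun1.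
  by apply/funext => w; case: (X w) (Y w) => [? ?] [? ?] /=; rewrite mulrN opprK.
rewrite (_ : (fun w => _) = fun w =>
  complex.Im (X w) * complex.Re (Y w) +
  -1 * (complex.Re (X w) * complex.Im (Y w))).
  by apply: Lfun_add => //; [|apply: Lfun_mull => //]; exact: Lfun2_mul_Lfun1.
apply/funext => w; case: (X w) (Y w) => [? ?] [? ?] /=.
by rewrite mulN1r mulrN addrC.
Qed.

Lemma L2D X Y : L2 P X -> L2 P Y -> L2 P (X \+ Y).
Proof.
move=> [X1 X2] [Y1 Y2]; split.
  rewrite (_ : (fun w => _) = fun w => complex.Re (X w) + complex.Re (Y w)).
    by apply: Lfun_add => //; rewrite ler1n.
  by apply/funext => w /=; case: (X w) (Y w) => [? ?] [? ?].
rewrite (_ : (fun w => _) = fun w => complex.Im (X w) + complex.Im (Y w)).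
  by apply: Lfun_add => //; rewrite ler1n.
by apply/funext => w /=; case: (X w) (Y w) => [? ?] [? ?].
Qed.

Lemma L2Z c X : L2 P X -> L2 P (c \*o X).
Proof.
case: c => a b [X1 X2]; have p1 : 1 <= 2 :> R by rewrite ler1n.
split.
  rewrite (_ : (fun w => _) =
    fun w => a * complex.Re (X w) + - b * complex.Im (X w)).
    by apply: Lfun_add => //; exact: Lfun_mull.
  by apply/funext => w /=; case: (X w) => [? ?] /=; rewrite mulNr.
rewrite (_ : (fun w => _) = fun w => a * complex.Im (X w) + b * complex.Re (X w)).
  by apply: Lfun_add => //; exact: Lfun_mull.
by apply/funext => w /=; case: (X w) => [? ?].
Qed.

Lemma L2B X Y : L2 P X -> L2 P Y -> L2 P (X \- Y).
Proof.
move=> X2 Y2; rewrite (_ : X \- Y = X \+ (-1 \*o Y)).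
  by apply: L2D => //; exact: L2Z.
by apply/funext => w /=; rewrite mulN1r.
Qed.

Lemma L20 : L2 P (fun=> 0).
Proof. by split; rewrite Lfun_cst. Qed.

Lemma L2innerDl X Y Z : L2 P X -> L2 P Y -> L2 P Z ->
  L2inner P (X \+ Y) Z = L2inner P X Z + L2inner P Y Z.
Proof.
move=> X2 Y2 Z2; rewrite /L2inner -cexpectD; [|exact: L2_mul_conj..].
by congr cexpect; apply/funext => w /=; rewrite mulrDl.
Qed.

Lemma L2innerZl c X Z : L2 P X -> L2 P Z ->
  L2inner P (c \*o X) Z = c * L2inner P X Z.
Proof.
move=> X2 Z2; rewrite /L2inner -cexpectZ; last exact: L2_mul_conj.
by congr cexpect; apply/funext => w /=; rewrite mulrA.
Qed.

Lemma L2innerC X Y : L2 P X -> L2 P Y -> L2inner P Y X = (L2inner P X Y)^*.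
Proof.
move=> X2 Y2; rewrite /L2inner -cexpect_conj; last exact: L2_mul_conj.
by congr cexpect; apply/funext => w /=; rewrite rmorphM/= conjcK mulrC.
Qed.

Lemma L2innerBl X Y Z : L2 P X -> L2 P Y -> L2 P Z ->
  L2inner P (X \- Y) Z = L2inner P X Z - L2inner P Y Z.
Proof.
move=> X2 Y2 Z2; rewrite (_ : X \- Y = X \+ (-1 \*o Y)).
  by rewrite L2innerDl ?L2innerZl ?mulN1r//; exact: L2Z.
by apply/funext => w /=; rewrite mulN1r.
Qed.

Lemma L2innerBr X Y Z : L2 P X -> L2 P Y -> L2 P Z ->
  L2inner P Z (X \- Y) = L2inner P Z X - L2inner P Z Y.
Proof.
move=> X2 Y2 Z2; have XY2 := L2B X2 Y2.
by rewrite (L2innerC XY2 Z2) L2innerBl// rmorphB/= (L2innerC X2) ?(L2innerC Y2).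
Qed.

Lemma L2innerZr c X Z : L2 P X -> L2 P Z ->
  L2inner P Z (c \*o X) = c^* * L2inner P Z X.
Proof.
move=> X2 Z2; have cX2 := L2Z c X2.
by rewrite (L2innerC cX2) // L2innerZl// rmorphM/= (L2innerC X2).
Qed.

Lemma L2inner0r X : L2inner P X (fun=> 0) = 0.
Proof.
rewrite /L2inner; under eq_fun => w do rewrite conjc0 mulr0.
by rewrite /cexpect/= !expectation_cst.
Qed.

Lemma ae_eq_L2inner X X' Z : L2 P X -> L2 P X' -> L2 P Z ->
  {ae P, forall w, X w = X' w} -> L2inner P X Z = L2inner P X' Z.
Proof.
move=> X2 X'2 Z2 XX'.
have [ReXZ ImXZ] := L2_mul_conj X2 Z2.
have [ReX'Z ImX'Z] := L2_mul_conj X'2 Z2.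
rewrite /L2inner /cexpect unlock; congr (fine _ +i* fine _).
  apply: ae_eq_integral => //.
  - by case/Lfun1_integrable/integrableP: ReXZ.
  - by case/Lfun1_integrable/integrableP: ReX'Z.
  - by apply: filterS XX' => w /= ->.
apply: ae_eq_integral => //.
- by case/Lfun1_integrable/integrableP: ImXZ.
- by case/Lfun1_integrable/integrableP: ImX'Z.
- by apply: filterS XX' => w /= ->.
Qed.

End Inner.

(** * Squared norm, Cauchy-Schwarz and orthogonality to a closure *)

Section Norm.
Local Open Scope classical_set_scope.
Local Open Scope complex_scope.
Context {d : measure_display} {T : measurableType d} {R : realType}.
Variable P : probability T R.
Implicit Types (X Y Z U W : T -> R[i]) (c z : R[i]).
Implicit Types (L M F G : set (T -> R[i])).

Definition normsq (z : R[i]) : R := complex.Re z ^+ 2 + complex.Im z ^+ 2.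

Definition L2normsq X : R := complex.Re (L2inner P X X).

Lemma normsq_ge0 z : 0 <= normsq z.
Proof. by rewrite addr_ge0 ?sqr_ge0. Qed.

Lemma normsq_le0 z : normsq z <= 0 -> z = 0.
Proof.
case: z => a b; rewrite /normsq/= => h.
have a0 := sqr_ge0 a; have b0 := sqr_ge0 b.
have /eqP : a ^+ 2 = 0 by lra.
have /eqP : b ^+ 2 = 0 by lra.
by rewrite !sqrf_eq0 => /eqP -> /eqP ->.
Qed.

Lemma normsqD z1 z2 : normsq (z1 + z2) <= 2 * (normsq z1 + normsq z2).
Proof.
case: z1 z2 => [a b] [a' b']; rewrite /normsq/=.
by have := sqr_ge0 (a - a'); have := sqr_ge0 (b - b'); rewrite !expr2; nra.
Qed.

Lemma L2normsqE X : L2 P X -> ((L2normsq X)%:E =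
  \int[P]_w (complex.Re (X w) ^+ 2)%:E + \int[P]_w (complex.Im (X w) ^+ 2)%:E)%E.
Proof.
move=> [X1 X2].
have /Lfun1_integrable iX1 := Lfun2_mul_Lfun1 X1 X1.
have /Lfun1_integrable iX2 := Lfun2_mul_Lfun1 X2 X2.
rewrite /L2normsq/= fineK; last first.
  by apply: expectation_fin_num; case: (L2_mul_conj (conj X1 X2) (conj X1 X2)).
rewrite -integralD//.
rewrite unlock; apply: eq_integral => w _; rewrite -EFinD; congr EFin.
by case: (X w) => a b /=; rewrite mulrN opprK !expr2.
Qed.

Lemma L2normsq_ge0 X : L2 P X -> 0 <= L2normsq X.
Proof.
move=> X2; rewrite -lee_fin L2normsqE//.
by rewrite adde_ge0// integral_ge0// => w _; rewrite lee_fin sqr_ge0.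
Qed.

Lemma L2normsqZ c X : L2 P X -> L2normsq (c \*o X) = normsq c * L2normsq X.
Proof.
move=> X2; rewrite /L2normsq L2innerZl// ?L2innerZr//; last exact: L2Z.
rewrite /normsq; case: c => a b; case: (L2inner P X X) => [u v] /=.
by ring.
Qed.

Lemma L2normsqB X Y : L2 P X -> L2 P Y -> L2normsq (X \- Y) =
  L2normsq X - 2 * complex.Re (L2inner P X Y) + L2normsq Y.
Proof.
move=> X2 Y2; rewrite /L2normsq L2innerBl ?L2innerBr//; try exact: L2B.
rewrite (L2innerC X2 Y2).
case: (L2inner P X X) (L2inner P X Y) (L2inner P Y Y) => [? ?] [? ?] [? ?] /=.
by ring.
Qed.

Lemma L2normsqD X Y : L2 P X -> L2 P Y -> L2normsq (X \+ Y) =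
  L2normsq X + 2 * complex.Re (L2inner P X Y) + L2normsq Y.
Proof.
move=> X2 Y2; rewrite (_ : X \+ Y = X \- (-1 \*o Y)); last first.
  by apply/funext => w /=; rewrite mulN1r opprK.
rewrite L2normsqB// ?L2normsqZ ?L2innerZr//; last exact: L2Z.
rewrite /normsq; case: (L2inner P X Y) => [? ?] /=.
by ring.
Qed.

(** If no [U - c W] is shorter than [U] by more than [e] in squared norm, then
    taking [c] to be [t] times the inner product makes the gain a quadratic
    polynomial in the real [t], whose discriminant gives the bound. With [e] the
    squared norm of [U] this is Cauchy-Schwarz; with [U] the distance vector to
    an almost minimising point it says that [U] is almost orthogonal to [W]. *)
Lemma L2inner_le_of_min U W (e : R) : L2 P U -> L2 P W ->
    (forall c, L2normsq U - e <= L2normsq (U \- (c \*o W))) ->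
  normsq (L2inner P U W) <= e * L2normsq W.
Proof.
move=> U2 W2 min.
set z := L2inner P U W; set N := normsq z; set k := L2normsq W.
have N0 : 0 <= N by exact: normsq_ge0.
have k0 : 0 <= k by exact: L2normsq_ge0.
have key (t : R) : 2 * t * N <= e + t ^+ 2 * N * k.
  have := min ((t +i* 0) * z).
  rewrite L2normsqB ?L2normsqZ ?L2innerZr//; last exact: L2Z.
  rewrite -/z -/k /N /normsq; case: (z) => a b /=; rewrite !expr2; lra.
have e0 : 0 <= e by have := key 0; rewrite !mulr0 mul0r expr2 !mul0r addr0.
have [N00|Npos] := eqVneq N 0; first by rewrite N00 mulr_ge0.
have {N0 Npos}N0 : 0 < N by rewrite lt0r Npos.
have [k00|kpos] := eqVneq k 0.
  (* Any [t] with [2 * t * N > e] contradicts [key]. *)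
  have := key ((e + 1) / N).
  rewrite k00 mulr0 addr0 -mulrA divfK ?gt_eqF//; lra.
have {k0 kpos}k0 : 0 < k by rewrite lt0r kpos.
(* The minimum of the quadratic polynomial is at [t = 1 / k]. *)
rewrite -ler_pdivrMr//; have := key k^-1.
rewrite (_ : k^-1 ^+ 2 * N * k = N / k); last by field; rewrite gt_eqF.
lra.
Qed.

Lemma L2_cauchy_schwarz X Y : L2 P X -> L2 P Y ->
  normsq (L2inner P X Y) <= L2normsq X * L2normsq Y.
Proof.
move=> X2 Y2; apply: L2inner_le_of_min => // c.
by rewrite subrr L2normsq_ge0//; apply: L2B => //; exact: L2Z.
Qed.

(** Limits of inner products and norms are taken through this lemma: the
    quantity [x] that should vanish is bounded by an error of geometric decay. *)
Lemma le0_of_geometric (x K : R) : (forall n, x <= 4^-1 ^+ n * K) -> x <= 0.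
Proof.
move=> xK; have cK : 4^-1 ^+ n * K @[n --> \oo] --> 0.
  rewrite -[X in _ --> X](mul0r K); apply: cvgMl.
  have := @cvg_geometric R 1 4^-1.
  rewrite /geometric/=; under eq_fun do rewrite mul1r; apply.
  by rewrite ger0_norm ?invr_ge0// invf_lt1// ltr1n.
rewrite -(cvg_lim _ cK)//; apply: limr_ge; last exact: nearW.
by apply/cvg_ex; exists 0.
Qed.

Lemma L2closure_L2 L X : L2closure P L X -> L2 P X.
Proof. by case. Qed.

Lemma sub_L2closure L : L `<=` L2 P -> L `<=` L2closure P L.
Proof.
move=> L2L X LX; have X2 := L2L _ LX; split=> // e e0; exists X => //.
rewrite /L2norm -/(L2normsq _) L2normsqB// /L2normsq.
by rewrite (_ : _ - _ + _ = 0) ?sqrtr0//; lra.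
Qed.

(** The inner product is continuous, by Cauchy-Schwarz. *)
Lemma orth_L2closure L X Y : L `<=` L2 P -> L2 P Y ->
    (forall Z, L Z -> L2inner P Z Y = 0) ->
  L2closure P L X -> L2inner P X Y = 0.
Proof.
move=> L2L Y2 LY [X2 clX]; apply/normsq_le0/(le0_of_geometric (K := L2normsq Y)).
move=> n; have e0 : 0 < (2^-1 : R) ^+ n by rewrite exprn_gt0 ?invr_gt0.
have [Z LZ XZ] := clX _ e0; have Z2 := L2L _ LZ; have XZ2 := L2B X2 Z2.
rewrite -[L2inner P X Y]subr0 -(LY Z LZ) -L2innerBl//.
apply: le_trans (L2_cauchy_schwarz XZ2 Y2) _.
rewrite ler_wpM2r ?L2normsq_ge0//.
rewrite -[leLHS]sqr_sqrtr ?L2normsq_ge0// -/(L2norm P _).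
rewrite (_ : 4^-1 = 2^-1 ^+ 2 :> R); last by field.
by rewrite exprAC lerXn2r ?nnegrE ?sqrtr_ge0 ?(ltW e0) ?ltW.
Qed.

End Norm.

(** * Completeness and the projection theorem *)

Section Projection.
Local Open Scope classical_set_scope.
Local Open Scope complex_scope.
Context {d : measure_display} {T : measurableType d} {R : realType}.
Variable P : probability T R.
Implicit Types (X Y Z U W : T -> R[i]) (c z : R[i]).
Implicit Types (L M F G : set (T -> R[i])).

(** The real completeness is applied to real and imaginary parts, which is
    where the factor [2] comes from. *)
Lemma L2_complete (Z : nat -> T -> R[i]) : (forall n, L2 P (Z n)) ->
    (forall n m, (n <= m)%N -> L2normsq P (Z n \- Z m) <= 4^-1 ^+ n) ->
  exists2 Zoo, L2 P Zoo &
    forall n, L2normsq P (Z n \- Zoo) <= 4^-1 ^+ n * 2.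
Proof.
move=> Z2 ZC.
have intC n m : (n <= m)%N ->
    (\int[P]_w ((complex.Re (Z n w) - complex.Re (Z m w)) ^+ 2)%:E <=
      (4^-1 ^+ n)%:E)%E /\
    (\int[P]_w ((complex.Im (Z n w) - complex.Im (Z m w)) ^+ 2)%:E <=
      (4^-1 ^+ n)%:E)%E.
  move=> nm; have := ZC n m nm; rewrite -lee_fin L2normsqE; last exact: L2B.
  set I1 := (integral _ _ _); set I2 := (integral _ _ _) => I12.
  have I10 : (0 <= I1)%E by apply: integral_ge0 => w _; rewrite lee_fin sqr_ge0.
  have I20 : (0 <= I2)%E by apply: integral_ge0 => w _; rewrite lee_fin sqr_ge0.
  split; apply: le_trans I12.
    apply: le_trans (leeDl _ I20); rewrite le_eqVlt; apply/orP; left.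
    apply/eqP/eq_integral => w _ /=; congr ((_ ^+ 2)%:E).
    by case: (Z n w) (Z m w) => [? ?] [? ?].
  apply: le_trans (leeDr _ I10); rewrite le_eqVlt; apply/orP; left.
  apply/eqP/eq_integral => w _ /=; congr ((_ ^+ 2)%:E).
  by case: (Z n w) (Z m w) => [? ?] [? ?].
have [g1 g1L g1P] := Lfun2_complete (fun n => (Z2 n).1)
  (fun n m nm => (intC n m nm).1).
have [g2 g2L g2P] := Lfun2_complete (fun n => (Z2 n).2)
  (fun n m nm => (intC n m nm).2).
have goo2 : L2 P (fun w => g1 w +i* g2 w) by split.
exists (fun w => g1 w +i* g2 w) => // n.
rewrite -lee_fin L2normsqE; last exact: L2B.
rewrite mulr_natr mulr2n EFinD; apply: leeD.
  apply: le_trans (g1P n); rewrite le_eqVlt; apply/orP; left.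
  apply/eqP/eq_integral => w _ /=; congr ((_ ^+ 2)%:E).
  by case: (Z n w).
apply: le_trans (g2P n); rewrite le_eqVlt; apply/orP; left.
apply/eqP/eq_integral => w _ /=; congr ((_ ^+ 2)%:E).
by case: (Z n w).
Qed.

Lemma orthC X Y : L2 P X -> L2 P Y -> L2inner P X Y = 0 -> L2inner P Y X = 0.
Proof. by move=> X2 Y2 XY0; rewrite (L2innerC X2 Y2) XY0 conjc0. Qed.

Lemma L2_parallelogram X Y : L2 P X -> L2 P Y ->
  L2normsq P (X \- Y) + L2normsq P (X \+ Y) =
  2 * (L2normsq P X + L2normsq P Y).
Proof. by move=> X2 Y2; rewrite L2normsqB// L2normsqD//; ring. Qed.

Definition L2subspace M := [/\ M `<=` L2 P, M (fun=> 0),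
  forall X Y, M X -> M Y -> M (X \+ Y) & forall c X, M X -> M (c \*o X)].

(** The projection theorem. The parallelogram identity turns a minimising
    sequence of the distance from [X] to [M] into a Cauchy sequence, whose limit
    is in the closure; along the sequence the distance vectors are almost
    orthogonal to [M], and orthogonality passes first to the limit and then from
    [M] to its closure. *)
Lemma is_oproj_ex M X : L2subspace M -> L2 P X ->
  exists Z, is_oproj P (L2closure P M) X Z.
Proof.
move=> [M2 M0 MD MZ] X2.
pose D := [set L2normsq P (X \- Z) | Z in M].
have D0 : has_inf D.
  split; first by exists (L2normsq P (X \- fun=> 0)), (fun=> 0).
  exists 0 => _ [Z MZ' <-]; apply/L2normsq_ge0/L2B => //; exact: M2.
pose delta := inf D.
have deltaP Z : M Z -> delta <= L2normsq P (X \- Z).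
  by move=> MZ'; apply: ge_inf; [exact: D0.2 | exists Z].
(* The division by [4] absorbs the factor that the parallelogram identity
   produces, so that the rate is the one needed for completeness. *)
pose e n : R := 4^-1 ^+ n / 4.
have e0 n : 0 < e n by rewrite divr_gt0// exprn_gt0// invr_gt0.
have /choice[Z ZP] : forall n, exists Zn,
    M Zn /\ L2normsq P (X \- Zn) < delta + e n.
  by move=> n; have [_ [Zn MZn <-] lt] := inf_adherent (e0 n) D0; exists Zn.
have ZM n : M (Z n) := (ZP n).1.
have Z2 n : L2 P (Z n) := M2 _ (ZM n).
have Zmin n : L2normsq P (X \- Z n) <= delta + e n := ltW (ZP n).2.
have ZC n m : (n <= m)%N -> L2normsq P (Z n \- Z m) <= 4^-1 ^+ n.
  move=> nm.
  have := L2_parallelogram (L2B X2 (Z2 m)) (L2B X2 (Z2 n)).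
  rewrite (_ : (X \- Z m) \- _ = Z n \- Z m); last first.
    by apply/funext => w /=; ring.
  rewrite (_ : _ \+ _ = 2 \*o (X \- (2^-1 \*o (Z n \+ Z m)))); last first.
    by apply/funext => w /=; field.
  rewrite L2normsqZ; last by apply/L2B/L2Z/L2D.
  have := deltaP _ (MZ 2^-1 _ (MD _ _ (ZM n) (ZM m))).
  have emn : e m <= e n.
    by rewrite /e ler_pM2r ?invr_gt0// ler_wiXn2l// ?invr_ge0// invf_le1// ler1n.
  have := Zmin n; have := Zmin m.
  rewrite (_ : 4^-1 ^+ n = 4 * e n); last by rewrite /e; field.
  rewrite (_ : normsq 2 = 4); last by rewrite /normsq /=; ring.
  lra.
have [Zoo Zoo2 ZooP] := L2_complete Z2 ZC.
have XZ2 : L2 P (X \- Zoo) by exact: L2B.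
exists Zoo; split.
  split=> // r r0; have [n rn] : exists n, 4^-1 ^+ n * 2 < r ^+ 2.
    apply/not_existsP => h; have : r ^+ 2 <= 0.
      by apply: (le0_of_geometric (K := 2)) => n; rewrite leNgt; apply/negP/h.
    by rewrite leNgt exprn_gt0.
  exists (Z n) => //; rewrite /L2norm -[ltRHS]gtr0_norm// -sqrtr_sqr.
  rewrite ltr_sqrt ?exprn_gt0//; apply: le_lt_trans rn.
  rewrite -/(L2normsq P _) (_ : Zoo \- Z n = -1 \*o (Z n \- Zoo)).
    rewrite L2normsqZ; last exact: L2B.
    by rewrite (_ : normsq (-1) = 1) ?mul1r//; rewrite /normsq/=; ring.
  by apply/funext => w /=; ring.
move=> W LW; have W2 := L2closure_L2 LW; apply: orthC => //.
apply: orth_L2closure LW => // {W2}W MW; have W2 := M2 _ MW.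
(* [9 / 2 = 2 * (1 / 4 + 2)]: the error at the [n]-th step is [e n] for the
   almost minimiser [Z n] and [4^-1 ^+ n * 2] for its distance to the limit. *)
apply: orthC => //; apply/normsq_le0.
apply: (le0_of_geometric (K := 9 / 2 * L2normsq P W)).
move=> n.
rewrite (_ : X \- Zoo = (X \- Z n) \+ (Z n \- Zoo)); last first.
  by apply/funext => w /=; ring.
have XZn2 := L2B X2 (Z2 n); have ZnZ2 := L2B (Z2 n) Zoo2.
rewrite L2innerDl//; apply: le_trans (normsqD _ _) _.
have : normsq (L2inner P (X \- Z n) W) <= e n * L2normsq P W.
  apply: L2inner_le_of_min => // c.
  rewrite (_ : (X \- Z n) \- _ = X \- (Z n \+ (c \*o W))); last first.
    by apply/funext => w /=; ring.
  have := deltaP _ (MD _ _ (ZM n) (MZ c _ MW)).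
  by have := Zmin n; lra.
have := L2_cauchy_schwarz ZnZ2 W2; have := ler_wpM2r (L2normsq_ge0 W2) (ZooP n).
rewrite /e; move: (_ ^+ n) => a; set K := L2normsq P W; lra.
Qed.

End Projection.

(** * Linear spans *)

Section Spans.
Local Open Scope classical_set_scope.
Local Open Scope complex_scope.
Context {d : measure_display} {T : measurableType d} {R : realType}.
Variable P : probability T R.
Implicit Types (X Y Z U W : T -> R[i]) (c z : R[i]).
Implicit Types (L M F G : set (T -> R[i])).

Lemma linspan_subspace F : L2subspace P (linspan P F).
Proof.
split.
- by move=> X [].
- split; first exact: L20.
  exists 0, (fun=> 0), (fun _ _ => 0); split; first by case.
  by apply: nearW => w; rewrite big_ord0.
- move=> X Y [X2 [n [c [f [fF fX]]]]] [Y2 [m [c' [g [gF gY]]]]].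
  split; first exact: L2D.
  exists (n + m)%N.
  exists (fun i => match fintype.split i with inl j => c j | inr j => c' j end).
  exists (fun i => match fintype.split i with inl j => f j | inr j => g j end).
  split; first by move=> i; case: (fintype.split i).
  apply: filterS2 fX gY => w /= -> ->; rewrite big_split_ord; congr (_ + _).
    by apply: eq_bigr => i _; rewrite (unsplitK (inl i)).
  by apply: eq_bigr => i _; rewrite (unsplitK (inr i)).
- move=> a X [X2 [n [c [f [fF fX]]]]]; split; first exact: L2Z.
  exists n, (fun i => a * c i), f; split=> //.
  apply: filterS fX => w /= ->; rewrite mulr_sumr.
  by apply: eq_bigr => i _; rewrite mulrA.
Qed.

Lemma mem_linspan F X : L2 P X -> F X -> linspan P F X.
Proof.
move=> X2 FX; split=> //; exists 1, (fun=> 1), (fun=> X); split=> //.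
by apply: nearW => w; rewrite big_ord1 mul1r.
Qed.

Lemma linspanS F G : F `<=` G -> linspan P F `<=` linspan P G.
Proof.
move=> FG X [X2 [n [c [f [fF fX]]]]]; split=> //; exists n, c, f; split=> // i.
exact/FG/fF.
Qed.

Lemma orth_linspan F X Y : F `<=` L2 P -> L2 P Y ->
    (forall Z, F Z -> L2inner P Z Y = 0) ->
  linspan P F X -> L2inner P X Y = 0.
Proof.
move=> F2 Y2 FY [X2 [n [c [f [fF fX]]]]].
suff {X X2 fX}[S2 SY] : L2 P (fun w => \sum_(i < n) c i * f i w) /\
    L2inner P (fun w => \sum_(i < n) c i * f i w) Y = 0.
  by rewrite -SY; apply: ae_eq_L2inner.
elim: n c f fF => [|n IHn] c f fF.
  under eq_fun do rewrite big_ord0.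
  by split; [exact: L20 | apply/orthC/L2inner0r => //; exact: L20].
under eq_fun do rewrite big_ord_recr/=.
have [S2 SY] := IHn (fun i => c (widen_ord (leqnSn n) i))
  (fun i => f (widen_ord (leqnSn n) i)) (fun i => fF _).
have f2 := F2 _ (fF ord_max); have cf2 := L2Z (c ord_max) f2.
split; first exact: L2D S2 cf2.
by rewrite (L2innerDl S2 cf2 Y2) SY L2innerZl// FY// mulr0 addr0.
Qed.

Lemma orth_closed_span F X Y : F `<=` L2 P -> L2 P Y ->
    (forall Z, F Z -> L2inner P Z Y = 0) ->
  L2closure P (linspan P F) X -> L2inner P X Y = 0.
Proof.
move=> F2 Y2 FY; apply: orth_L2closure => //; first by move=> Z [].
by move=> Z; exact: orth_linspan.
Qed.

(** * Conditional orthogonality of closed spans *)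

Section ClosedSubspace.
Variable M : set (T -> R[i]).
Hypothesis subM : L2subspace P M.
Let L := L2closure P M.

Lemma oprojP X : L2 P X -> is_oproj P L X (oproj P L X).
Proof. by move=> X2; exact: xgetPex (is_oproj_ex subM X2). Qed.

Lemma L2_oproj X : L2 P X -> L2 P (oproj P L X).
Proof. by move=> /oprojP[/L2closure_L2]. Qed.

Lemma L2_resid X : L2 P X -> L2 P (X \- oproj P L X).
Proof. by move=> X2; exact/L2B/L2_oproj. Qed.

(** Only one of the two residuals matters, since the projection of [Y] is in [L]
    and the residual of [X] is orthogonal to [L]. This is what makes conditional
    orthogonality linear and continuous in [Y] for fixed [X]. *)
Lemma L2inner_resid X Y : L2 P X -> L2 P Y ->
  L2inner P (X \- oproj P L X) (Y \- oproj P L Y) =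
  L2inner P (X \- oproj P L X) Y.
Proof.
move=> X2 Y2; rewrite L2innerBr//; [|exact: L2_oproj|exact: L2_resid].
by rewrite ((oprojP X2).2 _ (oprojP Y2).1) subr0.
Qed.

Lemma cond_orthC K1 K2 : K1 `<=` L2 P -> K2 `<=` L2 P ->
  cond_orth P K1 K2 L -> cond_orth P K2 K1 L.
Proof.
move=> K12 K22 K12L X Y K2X K1Y; have X2 := K22 _ K2X; have Y2 := K12 _ K1Y.
by apply: orthC (K12L _ _ K1Y K2X); exact: L2_resid.
Qed.

Lemma cond_orth_spanr K F : K `<=` L2 P -> F `<=` L2 P ->
  cond_orth P K F L -> cond_orth P K (L2closure P (linspan P F)) L.
Proof.
move=> K2 F2 KF X Y KX FY; have X2 := K2 _ KX; have Y2 := L2closure_L2 FY.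
have rX2 := L2_resid X2; rewrite L2inner_resid//; apply: orthC => //.
apply: orth_closed_span FY => // Z FZ; have Z2 := F2 _ FZ.
by apply: orthC => //; rewrite -L2inner_resid//; exact: KF.
Qed.

(** Conditional orthogonality is a property of generators: it extends to closed
    spans on one side at a time. *)
Lemma cond_orth_span F G : F `<=` L2 P -> G `<=` L2 P -> cond_orth P F G L ->
  cond_orth P (L2closure P (linspan P F)) (L2closure P (linspan P G)) L.
Proof.
move=> F2 G2 FG; have sF2 : L2closure P (linspan P F) `<=` L2 P by move=> Z [].
apply: cond_orth_spanr => //; apply: cond_orthC => //.
by apply: cond_orth_spanr => //; exact: cond_orthC.
Qed.

(** The residual of a member of [L] is almost surely null. The proof sees this as
    orthogonality of the residual of the other variable to that member. *)
Lemma cond_orth_self K1 K2 : K1 `<=` L -> K2 `<=` L2 P -> cond_orth P K1 K2 L.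
Proof.
move=> K1L K22 X Y K1X K2Y; have LX := K1L _ K1X; have Y2 := K22 _ K2Y.
have X2 := L2closure_L2 LX; have rX2 := L2_resid X2; have rY2 := L2_resid Y2.
apply: orthC => //; rewrite L2inner_resid//.
exact: (oprojP Y2).2.
Qed.

End ClosedSubspace.

Lemma cond_orthS K1 K2 K1' K2' L : K1' `<=` K1 -> K2' `<=` K2 ->
  cond_orth P K1 K2 L -> cond_orth P K1' K2' L.
Proof. by move=> s1 s2 K X Y /s1 KX /s2 KY; exact: K. Qed.

(** * The equivalence for processes *)

Section Process.
Context (k : nat) (Y : 'I_k -> R -> T -> R[i]).
Hypothesis Y2 : forall v t, L2 P (Y v t).
Implicit Types A B S : {set 'I_k}.

(** By definition [ell P Y A s t] is the linear span of this set; it is named so that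
    [calL P Y A s t] is recognised as the closed span of a set of generators. *)
Definition gens A (s t : \bar R) : set (T -> R[i]) :=
    [set X | exists a u, [/\ a \in A, (s <= u%:E <= t)%E & X = Y a u]].

Lemma gens_L2 A s t : gens A s t `<=` L2 P.
Proof. by move=> _ [a [u [_ _ ->]]]. Qed.

Lemma mem_ell A (a : 'I_k) (u : R) s t : a \in A -> (s <= u%:E <= t)%E ->
  ell P Y A s t (Y a u).
Proof. by move=> aA u_st; apply: mem_linspan => //; exists a, u. Qed.

Lemma ell_L2 A s t : ell P Y A s t `<=` L2 P. Proof. by move=> X []. Qed.

Lemma sub_ell_calL A s t : ell P Y A s t `<=` calL P Y A s t.
Proof. exact/sub_L2closure/ell_L2. Qed.

Lemma ellS A A' s s' t t' : A \subset A' -> (s' <= s)%E -> (t <= t')%E ->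
  ell P Y A s t `<=` ell P Y A' s' t'.
Proof.
move=> /fintype.subsetP AA' s's tt'; apply: linspanS.
move=> _ [a [u [aA /andP[su ut] ->]]].
exists a, u; split=> //; first exact: AA'.
by rewrite (le_trans s's su) (le_trans ut tt').
Qed.

Lemma cond_orth_gens A B A' s t s' t' r : (forall a b u u', a \in A -> b \in B ->
    (s <= u%:E <= t)%E -> (s' <= u'%:E <= t')%E ->
    cond_orth P [set Y b u] [set Y a u'] (calLpast P Y A' r)) ->
  cond_orth P (calL P Y B s t) (calL P Y A s' t') (calLpast P Y A' r).
Proof.
move=> ortho; apply: cond_orth_span; [exact: linspan_subspace|exact: gens_L2..|].
move=> _ _ [b [u [bB uI ->]]] [a [u' [aA u'I ->]]].
exact: (ortho a b u u').
Qed.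

End Process.
End Spans.

Theorem lemma3p3 (d : measure_display) (Omega : measurableType d) (R : realType)
    (P : probability Omega R) (k : nat) (Y : 'I_k -> R -> Omega -> R[i])
    (Ystat : weakly_stationary P Y) (Ycent : centered P Y)
    (Ycont : ms_continuous P Y)
    (A B S : {set 'I_k}) (AS : A \subset S) (BS : B \subset S)
    (AB : [disjoint A & B]) :
  [<-> Granger_noncausal P Y A B S;
       forall t : R,
         cond_orth P (calLpast P Y B (t + 1)) (calLpast P Y A t)
                     (calLpast P Y (S :\: A)%SET t);
       forall t : R,
         cond_orth P (ell P Y B t%:E (t + 1)%:E) (ell P Y A -oo%E t%:E)
                     (calLpast P Y (S :\: A)%SET t);
       forall (a b : 'I_k) (s s' t : R), a \in A -> b \in B ->
         t <= s <= t + 1 -> s' <= t ->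
         cond_orth P (ell P Y [set b]%SET s%:E s%:E)
                     (ell P Y [set a]%SET s'%:E s'%:E)
                     (calLpast P Y (S :\: A)%SET t)].
Proof.
have [Y2 _ _] := Ystat.
have memL (C : {set 'I_k}) a u s t :
    a \in C -> (s <= u%:E <= t)%E -> calL P Y C s t (Y a u).
  by move=> aC u_st; apply/sub_ell_calL/mem_ell.
tfae.
- move=> noncausal t; apply: cond_orth_gens => // a b u u' aA bB uI u'I.
  (* Before time [t] the variable [Y b u] is among the conditioning ones, as [b]
     is in [S] and not in [A]; from [t] on the hypothesis applies. *)
  have [tu|ut] := leP t u.
    apply: cond_orthS (noncausal t) => _ ->; last exact: memL.
    by apply: memL => //; rewrite lee_fin tu; case/andP: uI.
  apply: cond_orth_self; [exact: linspan_subspace| |by move=> _ ->].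
  move=> _ ->; apply: memL; last by rewrite leNye lee_fin ltW.
  by rewrite finset.in_setD (fintype.subsetP BS)// (disjointFl AB bB).
- move=> orth t; apply: cond_orthS (orth t); last exact: sub_ell_calL.
  by move=> X BX; apply: sub_ell_calL; apply: ellS BX; rewrite ?leNye.
- move=> orth a b s s' t aA bB /andP[ts st] s't.
  by apply: cond_orthS (orth t); apply: ellS;
    rewrite ?finset.sub1set ?lee_fin ?leNye.
- move=> orth t; apply: cond_orth_gens => // a b u u' aA bB uI u'I.
  have u't : u' <= t by case/andP: u'I.
  by apply: cond_orthS (orth a b u u' t aA bB uI u't) => _ ->;
    apply: mem_ell => //; rewrite ?finset.set11// lexx.
Qed.
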